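(* Let $\mu_{\mathbf X}$ and $\mu_{\mathbf Y}$ be Borel probability measures on $\mathbb{R}^n$ and $\mathbb{R}^m$ and let $\mu_{\mathbf U,\mathbf F}$ be a Borel probability measure on $\mathbb{R}^{n}\times\mathbb{R}^m$ with marginals $\mu_{\mathbf U}$ on $\mathbb{R}^n$ and $\mu_{\mathbf F}$ on $\mathbb{R}^m$. Let $S=(S_1,S_2):\mathbb{R}^{n+m}\to\mathbb{R}^{n+m}$ be an invertible map with inverse $S^{-1}=R=(R_1,R_2)$. Let $\mathcal M$ be a distance on the space of Borel probability measures on $\mathbb{R}^{n+m}$, and consider the losses $$\mathcal J_1(S)=\mathcal M\bigl((I_n,S_2)_\#(\mu_{\mathbf U}\otimes\mu_{\mathbf Y}),\ \mu_{\mathbf U,\mathbf F}\bigr),\qquad \mathcal J_2(R)=\mathcal M\bigl((R_1,I_m)_\#(\mu_{\mathbf X}\otimes\mu_{\mathbf F}),\ \mu_{\mathbf U,\mathbf F}\bigr),$$ $$\mathcal J_3(S)=\mathcal M\bigl(S_\#(\mu_{\mathbf U}\otimes\mu_{\mathbf Y}),\ \mu_{\mathbf X}\otimes\mu_{\mathbf F}\bigr),\qquad \mathcal J_4(R)=\mathcal M\bigl(R_\#(\mu_{\mathbf X}\otimes\mu_{\mathbf F}),\ \mu_{\mathbf U}\otimes\mu_{\mathbf Y}\bigr),$$ where $(I_n,S_2)(\mathbf u,\mathbf y)=(\mathbf u,S_2(\mathbf u,\mathbf y))$ and $(R_1,I_m)(\mathbf x,\mathbf f)=(R_1(\mathbf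 x,\mathbf f),\mathbf f)$. Then the following hold: (i) $\mathcal J_1(S)=0$ if and only if $(S_2(\mathbf u,\cdot))_\#\mu_{\mathbf Y}=\mu_{\mathbf F|\mathbf U=\mathbf u}$; (ii) $\mathcal J_2(R)=0$ if and only if $(R_1(\cdot,\mathbf f))_\#\mu_{\mathbf X}=\mu_{\mathbf U|\mathbf F=\mathbf f}$; (iii) $\mathcal J_3(S)=0$ if and only if $\mathcal J_4(R)=0$; (iv) $\mathcal J_3(S)=\mathcal J_1(S)=0$ implies $\mathcal J_2(R)=0$; (v) $\mathcal J_2(R)=\mathcal J_4(R)=0$ implies $\mathcal J_1(S)=0$.
   Context: Points of $\mathbb{R}^{n+m}=\mathbb{R}^n\times\mathbb{R}^m$ are written as pairs with first component in $\mathbb{R}^n$ and second in $\mathbb{R}^m$; maps into $\mathbb{R}^{n+m}$ are split accordingly. All maps are Borel with Borel inverses. $T_\#\mu=\mu\circ T^{-1}$ is the push-forward, $\otimes$ the product measure. $\mu_{\mathbf F|\mathbf U=\mathbf u}$ and $\mu_{\mathbf U|\mathbf F=\mathbf f}$ denote the conditional measures (disintegrations) of $\mu_{\mathbf U,\mathbf F}$ with respect to $\mu_{\mathbf U}$ and $\mu_{\mathbf F}$. Since disintegrations are unique only up to null sets, the identity in (i) (resp. (ii)) is understood for $\mu_{\mathbf U}$-a.e. $\mathbf u$ (resp. $\mu_{\mathbf F}$-a.e. $\mathbf f$). *)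

(* Defs.v *)
From HB Require Import structures.
From mathcomp Require Import all_boot all_order all_algebra.
From mathcomp Require Import all_classical all_reals all_analysis.

Set Implicit Arguments.
Unset Strict Implicit.
Unset Printing Implicit Defensive.

Import Order.TTheory GRing.Theory Num.Theory.

Local Open Scope classical_set_scope.
Local Open Scope ring_scope.

(* On [n.-tuple R] the library's sigma-algebra is generated by the coordinate
   projections, and the one on [R] is the Borel sigma-algebra, so that the
   measurable sets of [n.-tuple R] are the Borel sets of R^n, and those of
   [n.-tuple R * m.-tuple R] the Borel sets of R^(n+m). *)
Notation euclid R n := (n.-tuple (measurableTypeR R)).

Section measurable_maps.
Context d1 d2 (X : measurableType d1) (Y : measurableType d2).

HB.instance Definition _ :=
  isMeasurableFun.Build _ _ (X * Y)%type X (@fst X Y) measurable_fst.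

HB.instance Definition _ :=
  isMeasurableFun.Build _ _ (X * Y)%type Y (@snd X Y) measurable_snd.

(* The maps (I_n, S_2) and (R_1, I_m). *)
Definition keep_fst (S : X * Y -> X * Y) : X * Y -> X * Y :=
  fun z => (z.1, (S z).2).

Definition keep_snd (S : X * Y -> X * Y) : X * Y -> X * Y :=
  fun z => ((S z).1, z.2).

Lemma measurable_keep_fst (S : {mfun (X * Y)%type >-> (X * Y)%type}) :
  measurable_fun [set: X * Y] (keep_fst S).
Proof.
apply: measurable_fun_pair => //.
exact: (measurableT_comp measurable_snd (measurable_funPT S)).
Qed.

Lemma measurable_keep_snd (S : {mfun (X * Y)%type >-> (X * Y)%type}) :
  measurable_fun [set: X * Y] (keep_snd S).
Proof.
apply: measurable_fun_pair => //.
exact: (measurableT_comp measurable_fst (measurable_funPT S)).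
Qed.

HB.instance Definition _ (S : {mfun (X * Y)%type >-> (X * Y)%type}) :=
  isMeasurableFun.Build _ _ _ _ (keep_fst S) (measurable_keep_fst S).

HB.instance Definition _ (S : {mfun (X * Y)%type >-> (X * Y)%type}) :=
  isMeasurableFun.Build _ _ _ _ (keep_snd S) (measurable_keep_snd S).

End measurable_maps.

(* A library measure is a function on all sets, with no constraint on its values
   off the sigma-algebra: measures are equal when they agree on measurable
   sets, which is weaker than Leibniz equality. *)
Definition eq_measure_on_measurable d (T : measurableType d) (R : realType)
    (mu nu : set T -> \bar R) : Prop :=
  forall A, measurable A -> mu A = nu A.

Record is_distance d (T : measurableType d) (R : realType)
    (M : probability T R -> probability T R -> R) : Prop := IsDistance {
  dist_ge0 : forall mu nu, 0 <= M mu nu ;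
  dist_eq0 : forall mu nu, M mu nu = 0 <-> eq_measure_on_measurable mu nu ;
  dist_sym : forall mu nu, M mu nu = M nu mu ;
  dist_triangle : forall mu nu rho, M mu rho <= M mu nu + M nu rho }.

Section conditional_measures.
Context d1 d2 (X : measurableType d1) (Y : measurableType d2) (R : realType).
Implicit Type mu : probability (X * Y)%type R.
Local Open Scope ereal_scope.

Definition marginal_fst mu : probability X R := distribution mu (@fst X Y).

Definition marginal_snd mu : probability Y R := distribution mu (@snd X Y).

(* [k] is a version of the conditional measure mu_(F|U = u), resp. mu_(U|F = f):
   rectangles form a generating pi-system, so they determine the disintegration,
   which is unique up to a null set of the conditioning marginal. *)
Definition cond_given_fst mu (k : R.-pker X ~> Y) : Prop :=
  forall A B, measurable A -> measurable B ->
    mu (A `*` B) = \int[marginal_fst mu]_(x in A) k x B.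

Definition cond_given_snd mu (k : R.-pker Y ~> X) : Prop :=
  forall A B, measurable A -> measurable B ->
    mu (A `*` B) = \int[marginal_snd mu]_(y in B) k y A.

End conditional_measures.

Section losses.
Context d1 d2 (X : measurableType d1) (Y : measurableType d2) (R : realType).
Variables (M : probability (X * Y)%type R -> probability (X * Y)%type R -> R)
  (muX : probability X R) (muY : probability Y R)
  (muUF : probability (X * Y)%type R).
Implicit Type S : {mfun (X * Y)%type >-> (X * Y)%type}.

Let muU := marginal_fst muUF.
Let muF := marginal_snd muUF.

(* [J2] and [J4] are meant to be applied to the inverse of [S]. *)
Definition J1 S : R := M (distribution (muU \x muY)%E (keep_fst S)) muUF.

Definition J2 S : R := M (distribution (muX \x muF)%E (keep_snd S)) muUF.

Definition J3 S : R := M (distribution (muU \x muY)%E S) (muX \x muF)%E.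

Definition J4 S : R := M (distribution (muX \x muF)%E S) (muU \x muY)%E.

End losses.

(* Main.v *)
From HB Require Import structures.
Require Import Defs.
From mathcomp Require Import all_boot all_order all_algebra.
From mathcomp Require Import all_classical all_reals all_analysis.
From mathcomp Require Import measurable_realfun.

Set Implicit Arguments.
Unset Strict Implicit.
Unset Printing Implicit Defensive.

Import Order.TTheory GRing.Theory Num.Theory.

Local Open Scope classical_set_scope.
Local Open Scope ring_scope.

(* A measure on a product is determined by its values on rectangles, on which
   the transported product measure is the integral over A of the pushforwards of
   the sections.  Equality of these integrals with those of the disintegration
   for all A gives almost everywhere equality for each fixed B; a countable
   generating pi-system of R^m lets one exceptional null set serve for all B.
   The remaining claims are transport of measures along the identities
   (R_1, I_m) o S = (I_n, S_2) and (I_n, S_2) o R = (R_1, I_m). *)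

(** * Agreement of measures on generating pi-systems *)

Section finite_intersections.
Context {d} {T : measurableType d} {R : realType} {I : choiceType}.
Variable g : I -> set T.
Hypothesis gT : measurable = <<s range g >>.

Lemma measurable_big_setI (s : seq I) :
  measurable (\big[setI/setT]_(i <- s) g i).
Proof.
apply: big_ind => //; first exact: measurableI.
by move=> i _; rewrite gT; apply: sub_sigma_algebra; exists i.
Qed.

(** Finite intersections of generators form a pi-system: concatenating two lists intersects their
    sets, singleton lists give back the generators, and the empty list gives the whole space, whose
    finite mass allows uniqueness of measures to be applied. *)
Lemma eq_measure_big_setI (mu nu : {measure set T -> \bar R}) :
  (mu setT < +oo)%E ->
  (forall s : seq I, mu (\big[setI/setT]_(i <- s) g i) =
                     nu (\big[setI/setT]_(i <- s) g i)) ->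
  eq_measure_on_measurable mu nu.
Proof.
move=> muoo munu.
apply: (measure_unique (range (fun s => \big[setI/setT]_(i <- s) g i))
  (fun=> setT)).
- rewrite gT eqEsubset; split; apply: smallest_sub.
  + exact: smallest_sigma_algebra.
  + move=> _ [i _ <-]; apply: sub_sigma_algebra.
    by exists [:: i] => //; rewrite big_seq1.
  + exact: smallest_sigma_algebra.
  + move=> _ [s _ <-]; rewrite -gT; exact: measurable_big_setI.
- by move=> _ _ [s _ <-] [t _ <-]; exists (s ++ t) => //; rewrite big_cat.
- by move=> _; exists [::] => //; rewrite big_nil.
- by rewrite bigcup_const.
- by move=> _ [s _ <-].
- by [].
Qed.

End finite_intersections.

Lemma eq_measure_setX {d1 d2} {X : measurableType d1} {Y : measurableType d2}
    {R : realType} (mu nu : probability (X * Y)%type R) :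
  (forall A B, measurable A -> measurable B -> mu (A `*` B) = nu (A `*` B)) ->
  eq_measure_on_measurable mu nu.
Proof.
move=> munu; have muoo : (mu setT < +oo)%E by rewrite probability_setT ltry.
apply: (measure_unique
  [set A `*` B | A in measurable & B in measurable] (fun=> setT)).
- exact: measurable_prod_measurableType.
- move=> _ _ [A mA [B mB <-]] [A' mA' [B' mB' <-]].
  rewrite -setXI; exists (A `&` A'); first exact: measurableI.
  by exists (B `&` B') => //; exact: measurableI.
- by move=> _; exists setT => //; exists setT => //; rewrite setXTT.
- by rewrite bigcup_const.
- by move=> _ [A mA [B mB <-]]; exact: munu.
- by [].
Qed.

(** The condition on total mass serves twice: it bounds [j x B] by 1, hence makes it integrable, so
    that equal integrals give almost everywhere equality; and it gives the finite mass needed to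
    pass from the pi-system to all measurable sets. *)
Lemma ae_eq_kernel {d1 d2} {X : measurableType d1} {Y : measurableType d2}
    {R : realType} {I : countType} (g : I -> set Y) (mu : probability X R)
    (j k : X -> {measure set Y -> \bar R}) :
  measurable = <<s range g >> ->
  (forall B, measurable B -> measurable_fun setT (j ^~ B)) ->
  (forall B, measurable B -> measurable_fun setT (k ^~ B)) ->
  (forall x, j x setT = 1%E) ->
  (forall A B, measurable A -> measurable B ->
    \int[mu]_(x in A) j x B = \int[mu]_(x in A) k x B)%E <->
  {ae mu, forall x, eq_measure_on_measurable (j x) (k x)}.
Proof.
move=> gY mj mk j1; split=> [jk|jk A B mA mB]; last first.
  apply: ae_eq_integral => //.
  - exact: measurable_funS (mj _ mB).
  - exact: measurable_funS (mk _ mB).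
  - by apply: filterS jk => x jkx _; exact: jkx.
(* Finite intersections are indexed by [seq I], hence countably many. *)
pose P (n : nat) (x : X) := if (unpickle n : option (seq I)) is Some s
  then j x (\big[setI/setT]_(i <- s) g i) = k x (\big[setI/setT]_(i <- s) g i)
  else True.
have : {ae mu, forall x, forall n, P n x}.
  apply: ae_foralln => n; rewrite /P.
  case: unpickle => [s|]; last exact: aeW.
  have mG := measurable_big_setI gY s.
  have : ae_eq mu setT (j ^~ (\big[setI/setT]_(i <- s) g i))
                       (k ^~ (\big[setI/setT]_(i <- s) g i)).
    apply: integral_ae_eq => //; last by move=> E _ mE; exact: jk.
    - apply: (le_integrable measurableT (mj _ mG) _
        (finite_measure_integrable_cst mu 1 measurableT)) => x _ /=.
      rewrite gee0_abs// normr1 -(j1 x); apply: le_measure; rewrite ?inE//.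
    - exact: mk.
  by apply: filterS => x; exact.
apply: filterS => x jkx; apply: (eq_measure_big_setI gY).
  by rewrite j1 ltry.
by move=> s; have := jkx (pickle s); rewrite /P pickleK.
Qed.

(** Half-spaces with rational thresholds are countably many and still generate, since every open ray
    is a union of rays with rational endpoints. *)
Lemma euclid_generated (R : realType) (n : nat) :
  (measurable : set (set (euclid R n))) = <<s range
    (fun p : 'I_n * rat => [set t : euclid R n | tnth t p.1 < ratr p.2]) >>.
Proof.
set g := (fun p : 'I_n * rat => _).
rewrite eqEsubset; split; apply: smallest_sub; last 2 first.
- exact: sigma_algebra_measurable.
- move=> _ [[i q] _ <-].
  rewrite (_ : g _ = (fun t : euclid R n => tnth t i) @^-1` `]-oo, ratr q[).
    rewrite -[X in measurable X]setTI.
    by apply: measurable_tnth => //; exact: measurable_itv.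
  by apply/seteqP; split=> t; rewrite /g/= in_itv.
- exact: smallest_sigma_algebra.
- rewrite -bigcup_seq => _ [i _ [B mB <-]].
  (* The sets whose preimage under the [i]-th coordinate lies in the generated sigma-algebra
     themselves form a sigma-algebra, so it suffices to test open rays. *)
  have sI : sigma_algebra setT (image_set_system setT
    (fun t : euclid R n => tnth t i) <<s range g >>).
    exact/sigma_algebra_image/smallest_sigma_algebra.
  move: B mB.
  have -> : @measurable _ (measurableTypeR R) = <<s @RGenInftyO.G R >>.
    exact: RGenInftyO.measurableE.
  apply: smallest_sub => // _ [x ->]; rewrite /image_set_system/=.
  (* By density, [tnth t i < x] holds exactly when some rational lies strictly between the two. *)
  rewrite (_ : _ `&` _ = \bigcup_(q in [set q | ratr q < x]) g (i, q)).
    rewrite bigcup_mkcond.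
    apply: (@bigcupT_measurable_rat _ (g_sigma_algebraType (range g))) => q.
    case: ifP => _; last exact: measurable0.
    by apply: sub_sigma_algebra; exists (i, q).
  apply/seteqP; split=> t /=.
    rewrite in_itv/= => -[_ /rat_in_itvoo[q]]; rewrite in_itv/= => /andP[tq qx].
    by exists q.
  by move=> [q /= qx tq]; split => //; rewrite in_itv/=; exact: lt_trans tq qx.
Qed.

(** * Sections of a map and the transported product measure *)

Section sections.
Context {d1 d2} {X : measurableType d1} {Y : measurableType d2} {R : realType}.
Implicit Types S : {mfun (X * Y)%type >-> (X * Y)%type}.
Local Open Scope ereal_scope.

Lemma measurable_section_snd S (x : X) :
  measurable_fun setT (fun y => (S (x, y)).2).
Proof.
apply: (measurableT_comp measurable_snd).
apply: (measurableT_comp (measurable_funPT S)).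
exact: measurable_fun_pair.
Qed.

Lemma measurable_section_fst S (y : Y) :
  measurable_fun setT (fun x => (S (x, y)).1).
Proof.
apply: (measurableT_comp measurable_fst).
apply: (measurableT_comp (measurable_funPT S)).
exact: measurable_fun_pair.
Qed.

(** Packing the sections as measurable maps makes their pushforwards probability measures, as
    [ae_eq_kernel] expects of its kernel [j]. *)
Let section_snd S x : {mfun Y >-> Y} :=
  HB.pack (fun y => (S (x, y)).2)
    (isMeasurableFun.Build _ _ _ _ _ (measurable_section_snd S x)).

Let section_fst S y : {mfun X >-> X} :=
  HB.pack (fun x => (S (x, y)).1)
    (isMeasurableFun.Build _ _ _ _ _ (measurable_section_fst S y)).

Lemma measurable_preimage_snd S (B : set Y) : measurable B ->
  measurable ((fun z => (S z).2) @^-1` B).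
Proof.
move=> mB; rewrite -[X in measurable X]setTI.
exact: (measurableT_comp measurable_snd (measurable_funPT S)).
Qed.

Lemma measurable_preimage_fst S (A : set X) : measurable A ->
  measurable ((fun z => (S z).1) @^-1` A).
Proof.
move=> mA; rewrite -[X in measurable X]setTI.
exact: (measurableT_comp measurable_fst (measurable_funPT S)).
Qed.

Lemma measurable_pushforward_section_snd S (P : probability Y R) (B : set Y) :
  measurable B ->
  measurable_fun setT (fun x => pushforward P (fun y => (S (x, y)).2) B).
Proof.
move=> mB; apply: eq_measurable_fun
  (measurable_fun_xsection P (measurable_preimage_snd S mB)) => x _ /=.
by rewrite xsectionE.
Qed.

Lemma measurable_pushforward_section_fst S (P : probability X R) (A : set X) :
  measurable A ->
  measurable_fun setT (fun y => pushforward P (fun x => (S (x, y)).1) A).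
Proof.
move=> mA; apply: eq_measurable_fun
  (measurable_fun_ysection P (measurable_preimage_fst S mA)) => y _ /=.
by rewrite ysectionE.
Qed.

(** The product measure integrates the measures of [x]-sections. Since [keep_fst S] preserves the
    first coordinate, the section of the preimage at [x] is empty off [A] and is the preimage of [B]
    under [y |-> (S (x, y)).2] on [A]. *)
Lemma product_keep_fst_setX S (P : probability X R) (Q : probability Y R)
    (A : set X) (B : set Y) : measurable A -> measurable B ->
  (P \x Q) (keep_fst S @^-1` (A `*` B)) =
  \int[P]_(x in A) pushforward Q (fun y => (S (x, y)).2) B.
Proof.
move=> mA mB; rewrite [RHS]integral_mkcond; apply: eq_integral => x _ /=.
rewrite xsectionE patchE; case: ifPn => [/set_mem Ax|/negP xA].
  by congr (Q _); apply/seteqP; split=> y // [].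
rewrite (_ : _ @^-1` _ = set0) ?measure0//.
by apply/seteqP; split=> y // [] /= Ax _; apply: xA; rewrite inE.
Qed.

Lemma product_keep_snd_setX S (P : probability X R) (Q : probability Y R)
    (A : set X) (B : set Y) : measurable A -> measurable B ->
  (P \x Q) (keep_snd S @^-1` (A `*` B)) =
  \int[Q]_(y in B) pushforward P (fun x => (S (x, y)).1) A.
Proof.
(* [P \x Q] integrates over [x] first-coordinate slices, whereas here [y] is the fixed coordinate;
   [P \x^ Q] integrates [y]-sections and agrees with it on rectangles, hence on all measurable
   sets. *)
move=> mA mB; rewrite (@product_measure_unique _ _ _ _ _ P Q (P \x^ Q)).
- rewrite [RHS]integral_mkcond; apply: eq_integral => y _ /=.
  rewrite ysectionE patchE; case: ifPn => [/set_mem By|/negP yB].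
    by congr (P _); apply/seteqP; split=> x // [].
  rewrite (_ : _ @^-1` _ = set0) ?measure0//.
  by apply/seteqP; split=> x // [] /= _ By; apply: yB; rewrite inE.
- by move=> A' B' mA' mB'; exact: product_measure2E.
- rewrite -[X in measurable X]setTI.
  by apply: measurable_keep_snd => //; exact: measurableX.
Qed.

Lemma keep_fst_cond (I : countType) (g : I -> set Y) S (Q : probability Y R)
    (mu : probability (X * Y)%type R) (k : R.-pker X ~> Y) :
  measurable = <<s range g >> -> cond_given_fst mu k ->
  eq_measure_on_measurable
    (distribution (marginal_fst mu \x Q) (keep_fst S)) mu <->
  {ae marginal_fst mu, forall x,
    eq_measure_on_measurable (pushforward Q (fun y => (S (x, y)).2)) (k x)}.
Proof.
move=> gY kE.
(* The almost everywhere statement becomes equality of integrals over all [A], and these integrals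
   are the values of the two measures on rectangles. *)
rewrite -(ae_eq_kernel (marginal_fst mu)
  (j := fun x => distribution Q (section_snd S x)) gY).
- split=> [muE A B mA mB|jk].
    rewrite -kE// -product_keep_fst_setX//.
    exact: muE _ (measurableX mA mB).
  apply: eq_measure_setX => A B mA mB.
  rewrite (kE A B mA mB) -(jk A B mA mB).
  exact: product_keep_fst_setX.
- exact: measurable_pushforward_section_snd.
- exact: measurable_kernel.
- by move=> x; exact: probability_setT.
Qed.

Lemma keep_snd_cond (I : countType) (g : I -> set X) S (P : probability X R)
    (mu : probability (X * Y)%type R) (k : R.-pker Y ~> X) :
  measurable = <<s range g >> -> cond_given_snd mu k ->
  eq_measure_on_measurable
    (distribution (P \x marginal_snd mu) (keep_snd S)) mu <->
  {ae marginal_snd mu, forall y,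
    eq_measure_on_measurable (pushforward P (fun x => (S (x, y)).1)) (k y)}.
Proof.
move=> gX kE.
rewrite -(ae_eq_kernel (marginal_snd mu)
  (j := fun y => distribution P (section_fst S y)) gX).
- split=> [muE B A mB mA|jk].
    rewrite -kE// -product_keep_snd_setX//.
    exact: muE _ (measurableX mA mB).
  apply: eq_measure_setX => A B mA mB.
  rewrite (kE A B mA mB) -(jk B A mB mA).
  exact: product_keep_snd_setX.
- exact: measurable_pushforward_section_fst.
- exact: measurable_kernel.
- by move=> y; exact: probability_setT.
Qed.

End sections.

(** * Transport of measures along inverses and compositions *)

Section pushforwards.
Context {d} {T : measurableType d} {R : realType}.
Implicit Types (P Q mu : probability T R) (f g h : {mfun T >-> T}).

(** Evaluate the hypothesis at the preimage of [A] under [g]: pulling it back further along [f]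
    returns [A]. *)
Lemma eq_distribution_cancel P Q f g : cancel f g ->
  eq_measure_on_measurable (distribution P f) Q ->
  eq_measure_on_measurable (distribution Q g) P.
Proof.
move=> fK PQ A mA; rewrite /distribution/= /pushforward.
rewrite -PQ; last first.
  by rewrite -[X in measurable X]setTI; exact: measurable_funPT.
congr (P _); apply/seteqP; split=> x /=; by rewrite fK.
Qed.

(** Pushing [Q] along [g] amounts to pushing [P] along [g \o f], which is [h]. *)
Lemma eq_distribution_comp P Q mu f g h :
  g \o f =1 h ->
  eq_measure_on_measurable (distribution P f) Q ->
  eq_measure_on_measurable (distribution P h) mu ->
  eq_measure_on_measurable (distribution Q g) mu.
Proof.
move=> gfE PQ Pmu A mA; rewrite -Pmu// /distribution/= /pushforward.
rewrite -PQ; last first.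
  by rewrite -[X in measurable X]setTI; exact: measurable_funPT.
by congr (P _); apply/seteqP; split=> x /=; rewrite -gfE.
Qed.

End pushforwards.

Theorem lemma3p7 (R : realType) (n m : nat)
    (muX : probability (euclid R n) R) (muY : probability (euclid R m) R)
    (muUF : probability (euclid R n * euclid R m)%type R)
    (M : probability (euclid R n * euclid R m)%type R ->
         probability (euclid R n * euclid R m)%type R -> R)
    (S Sinv : {mfun (euclid R n * euclid R m)%type >->
                    (euclid R n * euclid R m)%type})
    (hM : is_distance M) (SK : cancel S Sinv) (SinvK : cancel Sinv S) :
  (forall k : R.-pker (euclid R n) ~> (euclid R m), cond_given_fst muUF k ->
     J1 M muY muUF S = 0 <->
     {ae marginal_fst muUF, forall u,
       eq_measure_on_measurable (pushforward muY (fun y => (S (u, y)).2)) (k u)})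
  /\
  (forall k : R.-pker (euclid R m) ~> (euclid R n), cond_given_snd muUF k ->
     J2 M muX muUF Sinv = 0 <->
     {ae marginal_snd muUF, forall f,
       eq_measure_on_measurable (pushforward muX (fun x => (Sinv (x, f)).1)) (k f)})
  /\
  (J3 M muX muY muUF S = 0 <-> J4 M muX muY muUF Sinv = 0)
  /\
  (J3 M muX muY muUF S = 0 -> J1 M muY muUF S = 0 -> J2 M muX muUF Sinv = 0)
  /\
  (J2 M muX muUF Sinv = 0 -> J4 M muX muY muUF Sinv = 0 -> J1 M muY muUF S = 0).
Proof.
have M0 := dist_eq0 hM; rewrite /J1 /J2 /J3 /J4; split=> [k kE|].
  rewrite M0; apply: keep_fst_cond kE; exact: euclid_generated.
split=> [k kE|].
  rewrite M0; apply: keep_snd_cond kE; exact: euclid_generated.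
rewrite !M0; split; first by split; exact: eq_distribution_cancel.
split=> [SE S2E|R1E RE].
  (* Both sides send [(u, y)] to [(u, (S (u, y)).2)], because [Sinv] recovers [u]. *)
  suff E : keep_snd Sinv \o S =1 keep_fst S.
    exact: eq_distribution_comp E SE S2E.
  by move=> z; rewrite /keep_snd /keep_fst /= SK.
suff E : keep_fst S \o Sinv =1 keep_snd Sinv.
  exact: eq_distribution_comp E RE R1E.
by move=> z; rewrite /keep_snd /keep_fst /= SinvK.
Qed.
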